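(* Every Priestley topological algebra is the dual space of some bounded distributive lattice with additional operations. That is, let $\tau$ be an operational type and let $X$ be a Priestley topological algebra of type $\tau$. For each $n$-ary $f\in\tau$ let $R_f=\{(x_1,\ldots,x_n,z)\in X^n\times X\mid z\leq f(x_1,\ldots,x_n)\}$. Then there is a bounded distributive lattice $D$ with residual operations $f_i^\sharp:D^n\to D$ (for each $n$-ary $f\in\tau$ and $1\leq i\leq n$) such that $X$, equipped with the relations $R_f$, is isomorphic to the Priestley dual space of $D$ equipped with the relations dual to the operations $f_i^\sharp$.
   Context: All operation symbols of $\tau$ have finite arity $n\geq 1$. A Priestley space is a compact ordered topological space $X$ that is totally order disconnected: whenever $x\nleq y$ there is a clopen down-set $U$ with $y\in U$ and $x\notin U$. A Priestley topological algebra of type $\tau$ is a Priestley space with an algebra structure of type $\tau$ whose basic operations are continuous and order preserving. The Priestley dual space $X_D$ of a bounded distributive lattice $D$ has as points $x$ the prime filters $F_x$ of $D$, ordered by $x\leq y\iff F_x\supseteq F_y$, with topology generated by the sets $\eta_D(a)=\{x\mid a\in F_x\}$ and their complements, $a\in D$. Residual operations $f_i^{\sharp}:D^n\to D$, written $f_i^{\sharp}(a_1,\ldots,a_{i-1},a_{i+1},\ldots,a_n,c)$, turn finite joins in each of the first $n-1$ coordinates into meets and preserve finite meets in the last coordinate. The relation on $X_D$ dual to $f_i^\sharp$ is the set of $(x_1,\ldots,x_n,z)\in X_D^{n}\times X_D$ such that for all $a_j\in F_{x_j}$ ($j\neq i$) and all $c\notin F_z$ we have $f_i^\sharp(a_1,\ldots,a_{i-1},a_{i+1},\ldots,a_n,c)\notin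 F_{x_i}$. An isomorphism is an order isomorphism and homeomorphism which preserves and reflects the relations; here, for each $f$ and every $i$, it carries $R_f$ to the relation dual to $f_i^\sharp$. *)

(* Defs.v *)
From HB Require Import structures.
From mathcomp Require Import all_boot all_order.
From mathcomp Require Import all_classical topology.

Set Implicit Arguments.
Unset Strict Implicit.
Unset Printing Implicit Defensive.

Import Order.TTheory.

Local Open Scope classical_set_scope.
Local Open Scope order_scope.

Record operational_type := OperationalType {
  op_symbol : Type;
  arity : op_symbol -> nat;
  arity_gt0 : forall f, (0 < arity f)%N
}.

Definition down_set d (T : porderType d) (U : set T) : Prop :=
  forall x y : T, x <= y -> U y -> U x.

Definition priestley_space d (X : POrderedTopological.type d) : Prop :=
  compact [set: X] /\
  (forall x y : X, ~~ (x <= y) ->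
     exists U : set X, [/\ clopen U, down_set U, U y & ~ U x]).

(* Continuity is with respect to the product topology ([ptws]), order
   preservation with respect to the product order. *)
Definition priestley_topological_algebra (tau : operational_type) d
    (X : POrderedTopological.type d)
    (op : forall f : op_symbol tau, ('I_(arity f) -> X) -> X) : Prop :=
  [/\ priestley_space X,
      (forall f, continuous (op f : {ptws 'I_(arity f) -> X} -> X)) &
      (forall f (x y : 'I_(arity f) -> X),
         (forall i, x i <= y i) -> op f x <= op f y)].

Section PriestleyDual.
Context {d : Order.disp_t} (D : tbDistrLatticeType d).

Definition prime_filter (F : set D) : Prop :=
  [/\ F \top,
      ~ F \bot,
      (forall a b, a <= b -> F a -> F b),
      (forall a b, F a -> F b -> F (a `&` b)) &
      (forall a b, F (a `|` b) -> F a \/ F b)].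

Record priestley_dual := PriestleyDual {
  dual_filter :> set D;
  dual_filterP : prime_filter dual_filter
}.

Lemma dual_filter_inj : injective dual_filter.
Proof.
move=> [F hF] [G hG] /= eFG; rewrite -{}eFG in hG *.
by congr PriestleyDual; exact: Prop_irrelevance.
Qed.

HB.instance Definition _ := gen_eqMixin priestley_dual.
HB.instance Definition _ := gen_choiceMixin priestley_dual.

Definition dual_le (x y : priestley_dual) : bool :=
  `[< dual_filter y `<=` dual_filter x >].

Lemma dual_le_refl : reflexive dual_le.
Proof. by move=> x; apply/asboolP. Qed.

Lemma dual_le_anti : antisymmetric dual_le.
Proof.
move=> x y /andP[/asboolP yx /asboolP xy].
by apply: dual_filter_inj; rewrite eqEsubset.
Qed.

Lemma dual_le_trans : transitive dual_le.
Proof.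
by move=> y x z /asboolP yx /asboolP zy; apply/asboolP/(subset_trans zy).
Qed.

Fact priestley_dual_display : Order.disp_t. Proof. exact: Order.Disp tt tt. Qed.

HB.instance Definition _ := Order.Le_isPOrder.Build
  priestley_dual_display priestley_dual
  dual_le_refl dual_le_anti dual_le_trans.

Definition dual_eta (a : D) : set priestley_dual := [set x | dual_filter x a].

HB.instance Definition _ := isSubBaseTopological.Build priestley_dual
  [set U | exists a, U = dual_eta a \/ U = (~` dual_eta a)%classic] id.

End PriestleyDual.

(* For [i : 'I_n], an operation [g a c] represents an [n]-ary operation
   D^n -> D whose first n-1 coordinates are those j <> i: the argument a_j with
   j = [lift i k] is [a k].  The last coordinate is [c]. *)
Definition residual_operation d (D : tbDistrLatticeType d) (n : nat)
    (g : ('I_n.-1 -> D) -> D -> D) : Prop :=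
  (forall (a : 'I_n.-1 -> D) (k : 'I_n.-1) (s : seq D) (c : D),
     g [eta a with k |-> \join_(b <- s) b] c =
     \meet_(b <- s) g [eta a with k |-> b] c) /\
  (forall (a : 'I_n.-1 -> D) (s : seq D),
     g a (\meet_(c <- s) c) = \meet_(c <- s) g a c).

Definition dual_relation d (D : tbDistrLatticeType d) (n : nat) (i : 'I_n)
    (g : ('I_n.-1 -> D) -> D -> D)
    (x : 'I_n -> priestley_dual D) (z : priestley_dual D) : Prop :=
  forall (a : 'I_n.-1 -> D) (c : D),
    (forall k, dual_filter (x (lift i k)) (a k)) ->
    ~ dual_filter z c -> ~ dual_filter (x i) (g a c).

Definition op_relation d (X : porderType d) (n : nat)
    (f : ('I_n -> X) -> X) (x : 'I_n -> X) (z : X) : Prop :=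
  z <= f x.

Definition order_homeomorphism d (X : POrderedTopological.type d)
    d' (Y : POrderedTopological.type d') (phi : X -> Y) : Prop :=
  [/\ {mono phi : x y / x <= y},
      continuous phi &
      exists psi : Y -> X,
        [/\ cancel phi psi, cancel psi phi & continuous psi]].

(* Main.v *)
Require Import Defs.
From HB Require Import structures.
From mathcomp Require Import all_boot all_order.
From mathcomp Require Import all_classical topology.

Set Implicit Arguments.
Unset Strict Implicit.
Unset Printing Implicit Defensive.

Import Order.TTheory.

(** The lattice is forced by Priestley duality: [D] consists of the clopen
    down-sets of [X].  A point [x] is sent to the filter of the clopen down-sets
    that contain it; total order disconnectedness makes this an order embedding,
    compactness makes every prime filter of this form ([dual_point_surj]), and a
    continuous bijection from a compact space onto a Hausdorff one is a
    homeomorphism ([dual_point_homeomorphism]).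

    The residual of [f] in coordinate [i] is the implication
<<
      f# (a, c) = {x | f (y) in c for all y with y_i = x, y_j in a_j (j <> i)}.
>>
    It is a down-set because [f] is monotone.  Its complement is the projection
    to coordinate [i] of a clopen subset of the power [X^n]; projections are open
    maps, and they are closed maps too because [X] is compact and Hausdorff, so
    [f# (a, c)] is clopen ([residual_setP]).  It sends joins in [a] to meets and
    preserves meets in [c] already as an operation on sets.

    It remains to compare [z <= f x] with the dual relation.  If [z <= f x], then
    [x_j in a_j] and [x_i in f# (a, c)] put [f x], hence [z], in [c].
    If [z] is not below [f x], some clopen down-set [c] contains [f x] but not
    [z], and one needs a box [a] around [x] with [x_i in f# (a, c)].  If every
    box failed, compactness of [X^n] would give one [y] that lies in all boxes,
    has [y_i = x_i], and satisfies [f y notin c].  Lying in all boxes means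
    [y <= x], so [f y <= f x] would be in [c] ([residual_box]). *)

Local Open Scope order_scope.
Local Open Scope classical_set_scope.

(** * Compactness and order separation *)

(** The family is a base of a proper filter, and a cluster point of that filter
    lies in each of the closed sets.  Directedness spares the usual passage to
    finite intersections. *)
Lemma compact_directed_inter (T : topologicalType) (I : Type) (D : set I)
    (F : I -> set T) :
  compact [set: T] -> D !=set0 ->
  (forall i j, D i -> D j -> exists2 k, D k & F k `<=` F i `&` F j) ->
  (forall i, D i -> closed (F i)) -> (forall i, D i -> F i !=set0) ->
  exists x, forall i, D i -> F i x.
Proof.
move=> cT D0 Fdir Fcl Fn0.
have FF : Filter (filter_from D F) by exact: filter_from_filter.
have PF : ProperFilter (filter_from D F) by exact: filter_from_proper.
have [x [_ clx]] := cT _ PF filterT.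
exists x => i Di; apply: Fcl => //= N Nx.
by apply: clx => //; exists i.
Qed.

Section OrderSeparation.
Context {d : Order.disp_t} {X : POrderedTopological.type d}.

(** Of two distinct points one is not below the other; the clopen set that
    separates them and its complement are disjoint neighbourhoods. *)
Lemma order_disconnected_hausdorff :
  (forall x y : X, ~~ (x <= y) ->
     exists U : set X, [/\ clopen U, down_set U, U y & ~ U x]) ->
  hausdorff_space X.
Proof.
move=> sepX x y clxy; apply/eqP/contraT; rewrite eq_le negb_and.
have sep (U : set X) p q : clopen U -> cluster (nbhs p) q -> U p -> U q.
  move=> [oU cU] clpq Up; apply: contrapT => nUq.
  have [] := clpq U (~` U); [by apply: open_nbhs_nbhs| |by move=> z []].
  by apply: open_nbhs_nbhs; split=> //; exact: closed_openC.
move=> /orP[]/sepX[U [cU _ Up nUq]]; last by case: nUq; exact: sep cU clxy _.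
by case: (sep (~` U) x y (clopenC set0 cU) clxy nUq).
Qed.

End OrderSeparation.

(** * The lattice of clopen down-sets *)

Section ClopenDownsets.
Context {d : Order.disp_t} (X : POrderedTopological.type d).

(** A boolean predicate, so that the lattice structure is inherited from the
    powerset through the sub-lattice constructors. *)
Definition clopen_down : pred (set X) :=
  fun U => `[< clopen U /\ down_set U >].

Record clopen_downset := ClopenDownset {
  downset_val :> set X;
  downset_valP : clopen_down downset_val
}.

HB.instance Definition _ := [isSub for downset_val].
HB.instance Definition _ := gen_eqMixin clopen_downset.
HB.instance Definition _ := [Choice of clopen_downset by <:].

Fact clopen_downset_display : Order.disp_t.
Proof. exact: Order.Disp tt tt. Qed.

Lemma clopen_downI : meet_closed clopen_down.
Proof.
move=> U V /asboolP[cU dU] /asboolP[cV dV]; apply/asboolP; split.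
  exact: clopenI.
by move=> x y xy [Uy Vy]; split; [apply: dU Uy|apply: dV Vy].
Qed.

Lemma clopen_downU : join_closed clopen_down.
Proof.
move=> U V /asboolP[cU dU] /asboolP[cV dV]; apply/asboolP; split.
  exact: clopenU.
by move=> x y xy [Uy|Vy]; [left; apply: dU Uy|right; apply: dV Vy].
Qed.

Lemma clopen_down0 : \bot \in clopen_down.
Proof. by apply/asboolP; split; [exact: clopen0|]. Qed.

Lemma clopen_downT : \top \in clopen_down.
Proof. by apply/asboolP; split; [exact: clopenT|]. Qed.

HB.instance Definition _ := Order.SubChoice_isTBSubLattice.Build
  _ _ clopen_down clopen_downset_display clopen_downset
  clopen_downI clopen_downU clopen_down0 clopen_downT.

Lemma clopen_downset_meetUl :
  left_distributive (@Order.meet _ clopen_downset) Order.join.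
Proof. by move=> U V W; apply: val_inj; exact: setIUl. Qed.

HB.instance Definition _ := Order.Lattice_Meet_isDistrLattice.Build
  clopen_downset_display clopen_downset clopen_downset_meetUl.

Lemma downset_clopen (U : clopen_downset) : clopen (U : set X).
Proof. by have /asboolP[] := downset_valP U. Qed.

Lemma downset_down (U : clopen_downset) : down_set (U : set X).
Proof. by have /asboolP[] := downset_valP U. Qed.

Lemma downset_le (U V : clopen_downset) : (U <= V) <-> (U `<=` V).
Proof. by rewrite -subsetEset. Qed.

Lemma downset_bigmeet (I : eqType) (s : seq I) (F : I -> clopen_downset) x :
  downset_val (\meet_(i <- s) F i) x <->
  forall i, i \in s -> downset_val (F i) x.
Proof.
elim: s => [|i s IHs]; first by rewrite big_nil; split.
rewrite big_cons; split=> [[Fix /IHs sx] j|sx].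
  by rewrite inE => /predU1P[->|/sx].
by split; [exact/sx/mem_head|apply/IHs=> j js; apply: sx; rewrite inE js orbT].
Qed.

Lemma downset_bigjoin (I : eqType) (s : seq I) (F : I -> clopen_downset) x :
  downset_val (\join_(i <- s) F i) x <->
  exists2 i, i \in s & downset_val (F i) x.
Proof.
elim: s => [|i s IHs]; first by rewrite big_nil; split=> [|[]].
rewrite big_cons; split=> [[Fix|/IHs[j js Fjx]]|[j]].
- by exists i; rewrite ?mem_head.
- by exists j; rewrite // inE js orbT.
rewrite inE => /predU1P[->|js] Fjx; first by left.
by right; apply/IHs; exists j.
Qed.

End ClopenDownsets.

(** * The topology of the dual space *)

Section DualTopology.
Context {d : Order.disp_t} {D : tbDistrLatticeType d}.

Lemma dual_eta_clopen (a : D) : clopen (dual_eta a).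
Proof.
have op (U : set (priestley_dual D)) :
    (exists a, U = dual_eta a \/ U = ~` dual_eta a) -> open U.
  move=> Ua; exists [set U]; last by rewrite bigcup_set1.
  by move=> _ ->; exact: (@finI_from1 _ _ _ id).
by split; [|rewrite -openC]; apply: op; exists a; [left|right].
Qed.

Lemma dual_continuous (T : topologicalType) (g : T -> priestley_dual D) :
  (forall a, clopen (g @^-1` dual_eta a)) -> continuous g.
Proof.
move=> gcl; apply/continuousP => _ [B sB <-].
rewrite preimage_bigcup; apply: bigcup_open => U /sB [E sE <-].
rewrite preimage_bigcap openE => t Et; apply: filter_bigI => V VE.
apply: open_nbhs_nbhs; split; last exact: Et.
have /set_mem[a [|] ->] := sE _ VE; first by case: (gcl a).
by case: (clopenC set0 (gcl a)).
Qed.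

(** The dual space is itself totally order disconnected: if [x] is not below
    [y], some [a] lies in the filter of [y] and not in that of [x], and then
    [dual_eta a] is a clopen down-set that separates them. *)
Lemma dual_hausdorff : hausdorff_space (priestley_dual D).
Proof.
apply: order_disconnected_hausdorff => x y.
move=> /asboolPn/existsNP[a /not_implyP[ya nxa]].
exists (dual_eta a); split=> //; first exact: dual_eta_clopen.
by move=> u v /asboolP vu; exact: vu.
Qed.
End DualTopology.

(** * A Priestley space is the dual of its clopen down-sets *)

Section PriestleyDuality.
Context {d : Order.disp_t} {X : POrderedTopological.type d}.
Local Notation D := (clopen_downset X).

Lemma neighbourhood_filterP (x : X) :
  prime_filter [set U : D | downset_val U x].
Proof.
split=> [//|[]|U V /downset_le UV /UV //|U V Ux Vx|U V [] Ux].
- by split.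
- by left.
- by right.
Qed.

Definition dual_point (x : X) : priestley_dual D :=
  PriestleyDual (neighbourhood_filterP x).

Hypothesis PX : priestley_space X.

Lemma downset_separation (x y : X) :
  ~~ (x <= y) -> exists U : D, downset_val U y /\ ~ downset_val U x.
Proof.
move=> /PX.2[U [cU dU Uy nUx]].
have PU : clopen_down U by apply/asboolP.
by exists (ClopenDownset PU).
Qed.

Lemma dual_point_mono : {mono dual_point : x y / x <= y}.
Proof.
move=> x y; apply/asboolP/idP => [yx|xy U]; last exact: downset_down.
by apply: contraT => /downset_separation[U [/yx]].
Qed.

(** For a prime filter [F], the differences [U \ V] with [U] in [F] and [V] not
    in [F] are closed and nonempty (otherwise [U <= V] would put [V] in [F]), and
    they are directed because [F] is closed under meets and prime.  A common
    point belongs to exactly the members of [F]. *)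
Lemma dual_point_surj (F : priestley_dual D) : exists x, dual_point x = F.
Proof.
case: F => F PF; have [FT F0 Fle FI FU] := PF.
have [x Fx] : exists x : X, forall UV : D * D, F UV.1 /\ ~ F UV.2 ->
    (downset_val UV.1 `\` downset_val UV.2) x.
  apply: (@compact_directed_inter _ _ [set UV : D * D | F UV.1 /\ ~ F UV.2]).
  - exact: PX.1.
  - by exists (\top, \bot).
  - move=> [U V] [U' V'] [/= FUU nFV] [/= FU' nFV'].
    exists (U `&` U', V `|` V')%O => /=; first by split; [exact: FI|case/FU].
    by move=> x [[Ux U'x] nVx]; split; split=> // Vx; apply: nVx; [left|right].
  - move=> [U V] _; rewrite setDE; apply: closedI.
      by case: (downset_clopen U).
    by apply: open_closedC; case: (downset_clopen V).
  - move=> [U V] [/= FUU nFV]; apply: contrapT => UV0; apply: nFV.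
    apply: Fle FUU; apply/downset_le => x Ux.
    by apply: contrapT => nVx; apply: UV0; exists x.
exists x; apply: dual_filter_inj; apply/seteqP; split=> U /= Ux.
  by apply: contrapT => nFU; have [] := Fx (\top, U) (conj FT nFU).
by have [] := Fx (U, \bot) (conj Ux F0).
Qed.

Lemma dual_point_bij :
  exists psi, cancel dual_point psi /\ cancel psi dual_point.
Proof.
have /choice[psi psiK] := dual_point_surj.
exists psi; split=> // x; apply: (inc_inj dual_point_mono); exact: psiK.
Qed.

Lemma dual_point_continuous : continuous dual_point.
Proof. by apply: dual_continuous => U; exact: downset_clopen. Qed.

Lemma dual_point_homeomorphism : order_homeomorphism dual_point.
Proof.
have [psi [phiK psiK]] := dual_point_bij.
split; first exact: dual_point_mono.
  exact: dual_point_continuous.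
exists psi; split=> //.
apply/continuous_closedP => A clA.
have -> : psi @^-1` A = dual_point @` A.
  apply/seteqP; split=> [F AF|_ [x Ax <-]]; last by rewrite /= phiK.
  by exists (psi F) => //; rewrite psiK.
apply: compact_closed; first exact: dual_hausdorff.
apply: continuous_compact.
  by apply: continuous_subspaceT; exact: dual_point_continuous.
by apply: subclosed_compact clA PX.1 _.
Qed.

End PriestleyDuality.

(** * Clopen sets in finite powers of a compact space *)

Section FiniteProducts.
Context {I : finType} {T : topologicalType}.

Lemma clopen_forall (U : topologicalType) (P : I -> set U) :
  (forall i, clopen (P i)) -> clopen [set x | forall i, P i x].
Proof.
move=> cP; have -> : [set x | forall i, P i x] =
    \big[setI/[set: U]]_(i <- enum I) P i.
  rewrite -bigcap_seq; apply/seteqP; split=> [x Px i _|x Px i].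
    exact: Px.
  by apply: Px; rewrite /= mem_enum.
by elim/big_ind: _; [exact: clopenT|exact: clopenI|].
Qed.

Lemma ptws_compact : compact [set: T] -> compact [set: {ptws I -> T}].
Proof.
move=> cT; have := @tychonoff I (fun=> T) (fun=> setT) (fun=> cT).
by rewrite (_ : [set _ | _] = setT) //; apply/seteqP; split.
Qed.

Lemma clopen_coordinate (i : I) (U : set T) :
  clopen U -> clopen ([set y | U (y i)] : set {ptws I -> T}).
Proof.
move=> cU; apply: (@preimage_clopen {ptws I -> T} T (fun y => y i)) => //.
exact: (@proj_continuous _ (fun=> T)).
Qed.

(** Projections are open maps; on a compact power of a Hausdorff space they are
    also closed maps. *)
Lemma clopen_proj (i : I) (S : set {ptws I -> T}) :
  compact [set: T] -> hausdorff_space T -> clopen S ->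
  clopen [set x | exists2 y, S y & y i = x].
Proof.
move=> cT hT [oS cS]; split; first exact: (@proj_open _ (fun=> T) i S oS).
apply: compact_closed => //.
apply: (@continuous_compact {ptws I -> T} T (fun y => y i)).
  by apply: continuous_subspaceT; exact: (@proj_continuous _ (fun=> T)).
apply: subclosed_compact cS (ptws_compact cT) _ => //.
Qed.

End FiniteProducts.

(** * Residuals of a continuous monotone operation *)

Section Residuals.
Context {d : Order.disp_t} {X : POrderedTopological.type d} {n : nat}.
Local Notation D := (clopen_downset X).
Variables (f : ('I_n -> X) -> X) (i : 'I_n).
Hypothesis PX : priestley_space X.
Hypothesis f_continuous : continuous (f : {ptws 'I_n -> X} -> X).
Hypothesis f_mono : forall x y, (forall j, x j <= y j) -> f x <= f y.

Definition residual_set (a : 'I_n.-1 -> D) (c : D) : set X :=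
  [set x | forall y, y i = x -> (forall k, downset_val (a k) (y (lift i k))) ->
                     downset_val c (f y)].

Lemma residual_setP a c : clopen_down (residual_set a c).
Proof.
apply/asboolP; split.
  pose S : set {ptws 'I_n -> X} :=
    [set y | forall k, downset_val (a k) (y (lift i k))] `&`
    ~` (f @^-1` downset_val c).
  have cS : clopen S.
    apply: clopenI.
      apply: clopen_forall => k.
      by apply: clopen_coordinate; exact: downset_clopen.
    by apply/clopenC/preimage_clopen => //; exact: downset_clopen.
  have -> : residual_set a c = ~` [set x | exists2 y, S y & y i = x].
    apply/seteqP; split=> x; first by move=> rx [y [ay ncy] yx]; apply/ncy/rx.
    move=> nSx y yx ay; apply: contrapT => ncy; apply: nSx.
    by exists y.
  apply: (clopenC set0); apply: clopen_proj => //; first by case: PX.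
  by apply: order_disconnected_hausdorff; exact: PX.2.
move=> x x' xx' rx' y yx ay.
(* raising coordinate [i] of [y] from [x] to [x'] can only raise [f y] *)
pose y' j := if j == i then x' else y j.
have /downset_down : f y <= f y'.
  by apply: f_mono => j; rewrite /y'; case: eqP => // ->; rewrite yx.
apply; apply: rx' => [|k]; first by rewrite /y' eqxx.
by rewrite /y' eq_sym (negPf (neq_lift _ _)).
Qed.

Definition residual a c : D := ClopenDownset (residual_setP a c).

Lemma residual_residual_operation : residual_operation residual.
Proof.
split=> [a k s c|a s]; apply: val_inj; apply/seteqP; split=> x.
- move=> rx; apply/downset_bigmeet => b bs y yx ay; apply: rx => // j.
  move: (ay j) => /=; case: eqP => // _ by_.
  by apply/downset_bigjoin; exists b.
- move=> /downset_bigmeet rx y yx ay.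
  have := ay k; rewrite /= eqxx => /downset_bigjoin[b bs by_].
  apply: (rx b bs y yx) => j; move: (ay j) => /=; case: eqP => // -> _.
  exact: by_.
- move=> rx; apply/downset_bigmeet => c cs y yx ay.
  by have /downset_bigmeet := rx y yx ay; apply.
- move=> /downset_bigmeet rx y yx ay; apply/downset_bigmeet => c cs.
  exact: rx yx ay.
Qed.

(** Tube lemma, in ordered form: boxes of clopen down-sets around [x], with the
    coordinate [i] held at [x i], shrink to the part of the principal down-set of
    [x] on which that coordinate is constant.  Monotonicity of [f] keeps this
    part inside the clopen set [f @^-1` c], so by compactness some box is inside
    it too. *)
Lemma residual_box (x : 'I_n -> X) (c : D) : downset_val c (f x) ->
  exists a : 'I_n.-1 -> D,
    (forall k, downset_val (a k) (x (lift i k))) /\ residual_set a c (x i).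
Proof.
move=> cfx; apply: contrapT => nbox.
have [y yP] : exists y : {ptws 'I_n -> X}, forall a : 'I_n.-1 -> D,
    (forall k, downset_val (a k) (x (lift i k))) ->
    [/\ y i = x i, forall k, downset_val (a k) (y (lift i k)) &
        ~ downset_val c (f y)].
  apply: (@compact_directed_inter {ptws 'I_n -> X} _
    [set a : 'I_n.-1 -> D | forall k, downset_val (a k) (x (lift i k))]
    (fun a => [set y | [/\ y i = x i,
      forall k, downset_val (a k) (y (lift i k)) & ~ downset_val c (f y)]])).
  - exact: ptws_compact PX.1.
  - by exists (fun=> \top).
  - move=> a b ax bx; exists (fun k => (a k `&` b k)%O).
      by move=> k; exact: conj (ax k) (bx k).
    by move=> y [yx aby ncy]; split; split=> // k; case: (aby k).
  - move=> a _; have hX := order_disconnected_hausdorff PX.2.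
    rewrite [X in closed X](_ : _ = (((fun y => y i) @^-1` [set x i] `&`
        [set y | forall k, downset_val (a k) (y (lift i k))]) `&`
        ~` (f @^-1` downset_val c))); last first.
      by apply/seteqP; split=> y; [case|case=> -[]].
    apply: closedI; first apply: closedI.
    + apply: (@preimage_closed {ptws 'I_n -> X} X).
        by move=> y _; exact: (@proj_continuous _ (fun=> X)).
      exact/accessible_closed_set1/hausdorff_accessible.
    + apply: (proj2 (clopen_forall _)) => k.
      by apply: clopen_coordinate; exact: downset_clopen.
    + have cfc := preimage_clopen (downset_clopen c) f_continuous.
      by case: (clopenC set0 cfc).
  - move=> a ax; apply: contrapT => nay; apply: nbox.
    exists a; split=> // y yx ay.
    by apply: contrapT => ncy; apply: nay; exists y.
have [yx _ ncy] := yP (fun=> \top) (fun=> I).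
apply: ncy; apply: downset_down cfx; apply: f_mono => j.
have [k ->|->] := unliftP i j; last by rewrite yx.
apply: contraT => /(downset_separation PX)[U [Ux nUy]].
(* [y] lies in the box that constrains only the coordinate [k], by [U] *)
case: nUy; have [|_ /(_ k)] := yP [eta (fun=> \top) with k |-> U].
  by move=> l /=; case: eqP => [->|].
by rewrite /= eqxx.
Qed.

Lemma op_relation_residual (x : 'I_n -> X) (z : X) :
  op_relation f x z <->
  dual_relation i residual (fun j => dual_point (x j)) (dual_point z).
Proof.
split=> [zfx a c ax ncz rx|rel].
  by apply: ncz; apply: downset_down zfx _; exact: rx.
apply: contraT => /(downset_separation PX)[c [cfx ncz]].
have [a [ax rx]] := residual_box cfx.
by case: (rel a c ax ncz).
Qed.

End Residuals.

Theorem corollary3p6 (tau : operational_type) (d : Order.disp_t)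
    (X : POrderedTopological.type d)
    (op : forall f : op_symbol tau, ('I_(arity f) -> X) -> X)
    (hX : priestley_topological_algebra op) :
  exists (d' : Order.disp_t) (D : tbDistrLatticeType d')
    (res : forall f : op_symbol tau, 'I_(arity f) ->
             ('I_(arity f).-1 -> D) -> D -> D),
    (forall f i, residual_operation (res f i)) /\
    exists phi : X -> priestley_dual D,
      order_homeomorphism phi /\
      (forall (f : op_symbol tau) (i : 'I_(arity f))
              (x : 'I_(arity f) -> X) (z : X),
         op_relation (op f) x z <->
         dual_relation i (res f i) (fun j => phi (x j)) (phi z)).

Proof.
have [PX opC opM] := hX.
exists clopen_downset_display, (clopen_downset X).
exists (fun f i => residual i PX (opC f) (opM f)).
split=> [f i|]; first exact: residual_residual_operation.
exists (@dual_point d X); split; first exact: dual_point_homeomorphism.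
by move=> f i x z; exact: op_relation_residual.
Qed.
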